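(* Let $\Bbbk$ be an algebraically closed field, $A=\Bbbk Q/I$ a finite dimensional algebra with $Q$ a finite quiver and $I$ an admissible ideal, and let $[f]\in\mathsf{HH}^2(A)$ be represented by a Hochschild $2$-cocycle $f\in\operatorname{Hom}_{E-E}(\operatorname{rad}A\otimes_E\operatorname{rad}A,A)$, $E=\Bbbk Q_0$, satisfying $\operatorname{Im}f\subset\hat f(I)$. Let $Q_f$ be the quiver and $I_f$ the ideal of $\Bbbk Q_f$ described in the context. Then there is an isomorphism of $\Bbbk$-algebras $$A_f\simeq\Bbbk Q_f/I_f .$$
   Context: Quivers: $Q=(Q_0,Q_1)$; $e_i$ is the trivial path at the vertex $i$; paths are written $w=\alpha_1\cdots\alpha_n$ with $t(\alpha_i)=s(\alpha_{i+1})$, $s(w)=s(\alpha_1)$, $t(w)=t(\alpha_n)$; multiplication in $\Bbbk Q$ is concatenation. A relation is a linear combination with nonzero coefficients of paths of length $\ge2$ all having the same source and the same target. $\bar x$ denotes the class in $A$ of $x\in\Bbbk Q$. Fix a set $\mathbb P$ of paths in $Q$ such that $\{\bar\gamma:\gamma\in\mathbb P\}$ is a basis of $A$, with span $\Bbbk\mathbb P\subset\Bbbk Q$, and a finite set of relations $\Gamma=\{\rho_1,\dots,\rho_m\}$ generating $I$. Cocycle: $E=\Bbbk Q_0$ is the span of the trivial paths, so $A=E\oplus\operatorname{rad}A$. An $E$-bimodule map $f:\operatorname{rad}A\otimes_E\operatorname{rad}A\to A$ is regarded as a $\Bbbk$-bilinear map on $A$ by letting it vanish whenever one of its arguments lies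 in $E$; it is a $2$-cocycle if $a_0f(a_1\otimes a_2)+f(a_0\otimes a_1a_2)=f(a_0a_1\otimes a_2)+f(a_0\otimes a_1)a_2$ for all $a_i\in A$. Every class in $\mathsf{HH}^2(A)$ (Hochschild cohomology of $A$ with coefficients in $A$) has such a representative. The algebra $A_f$ is $A\oplus A$ with product $(a_0,b_0)(a_1,b_1)=(a_0a_1,\;a_0b_1+b_0a_1+f(a_0\otimes a_1))$. The map $\hat f:\Bbbk Q\to A$ is the $\Bbbk$-linear map with $\hat f(\alpha_1\cdots\alpha_s)=0$ if $s=0,1$ and $\hat f(\alpha_1\cdots\alpha_s)=\sum_{i=1}^{s-1}f(\bar\alpha_1\cdots\bar\alpha_i\otimes\bar\alpha_{i+1})\,\bar\alpha_{i+2}\cdots\bar\alpha_s$ if $s\ge2$. For each $\rho\in\Gamma$, $w_\rho\in\Bbbk\mathbb P$ denotes the element with $\overline{w_\rho}=\hat f(\rho)$. The quiver $Q_f$ has vertices $(Q_f)_0=Q_0$ and arrows $(Q_f)_1=\{\hat\alpha:s(\alpha)\to t(\alpha)\mid\alpha\in Q_1\}\cup\{\hat e_i:i\to i\mid i\in Q_0,\ e_i\notin\operatorname{Im}f\}$. For a path $w=\alpha_1\cdots\alpha_s$ of $Q$ of length $s\ge1$ put $\hat w=\hat\alpha_1\cdots\hat\alpha_s$; the trivial path of $Q$ at $i$ is sent by $w\mapsto\hat w$ to the trivial path of $Q_f$ at $i$ (not to the loop $\hat e_i$); extend linearly to $\Bbbk Q\to\Bbbk Q_f$. For $i\in Q_0$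 set $\epsilon_i=\hat e_i$ if $e_i\notin\operatorname{Im}f$, and $\epsilon_i=\sum_j\mu_j\hat\rho_j$ if $e_i\in\operatorname{Im}f$, where $e_i=\hat f(\sum_j\mu_j\rho_j)$ is a fixed expression with $\mu_j\in\Bbbk$, $\rho_j\in\Gamma$ (the existence of such an expression for each $i$ with $e_i\in\operatorname{Im}f$ is part of the setting). The ideal $I_f$ of $\Bbbk Q_f$ is generated by: $\epsilon_i^2$ for $i\in Q_0$; $\epsilon_i\hat\alpha-\hat\alpha\epsilon_j$ for every arrow $\alpha:i\to j$ in $Q_1$; and $\hat\rho-\hat w_\rho\,\epsilon_{t(\rho)}$ for $\rho\in\Gamma$. *)

(* Defs.v *)
From HB Require Import structures.
From mathcomp Require Import all_boot all_order all_algebra sesquilinear.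
From mathcomp Require Import finmap.
From mathcomp.multinomials Require Import monalg.
From mathcomp Require Import boolp classical_sets.

Set Implicit Arguments.
Unset Strict Implicit.
Unset Printing Implicit Defensive.

Import GRing.Theory.

Local Open Scope classical_set_scope.
Local Open Scope ring_scope.
Local Open Scope quotient_scope.

(* The ring structures below are [pzRingType]s (the zero ring is allowed): the
   quiver may have no vertex, and a quotient by the unit ideal is not excluded
   beforehand. MathComp's [lalgType] requires 1 != 0, so a k-algebra appears
   here as a type that is both a [pzRingType] and an [lmodType k]. *)

Record quiver := Quiver {
  vert : finType;
  arr : finType;
  src : arr -> vert;
  tgt : arr -> vert }.

Section Paths.
Variable Q : quiver.

Fixpoint walk (v : vert Q) (s : seq (arr Q)) : bool :=
  if s is a :: s' then (src a == v) && walk (tgt a) s' else true.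

Definition walk_end (v : vert Q) (s : seq (arr Q)) : vert Q :=
  last v (map (@tgt Q) s).

(* A path is its starting vertex together with its sequence of arrows; the
   starting vertex is redundant unless the sequence is empty. *)
Record qpath := QPath {
  pval : vert Q * seq (arr Q);
  pvalP : walk pval.1 pval.2 }.

HB.instance Definition _ := [isSub for pval].
HB.instance Definition _ := [Countable of qpath by <:].

Definition psrc (p : qpath) : vert Q := (pval p).1.
Definition parr (p : qpath) : seq (arr Q) := (pval p).2.
Definition ptgt (p : qpath) : vert Q := walk_end (psrc p) (parr p).
Definition plen (p : qpath) : nat := size (parr p).

Definition ptriv (v : vert Q) : qpath := @QPath (v, [::]) isT.

Lemma arrow_walk (a : arr Q) : walk (src a) [:: a].
Proof. by rewrite /= eqxx. Qed.

Definition parrow (a : arr Q) : qpath :=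
  @QPath (src a, [:: a]) (arrow_walk a).

(* Concatenation; the value is meaningful only when [ptgt p = psrc q]. *)
Definition pcat (p q : qpath) : qpath :=
  insubd p (psrc p, parr p ++ parr q).

Lemma walk_cat v s t : walk v (s ++ t) = walk v s && walk (walk_end v s) t.
Proof. by elim: s v => //= a s IHs v; rewrite IHs andbA. Qed.

Lemma walk_end_cat v s t : walk_end v (s ++ t) = walk_end (walk_end v s) t.
Proof. by rewrite /walk_end map_cat last_cat. Qed.

Lemma pval_pcat p q : ptgt p = psrc q ->
  pval (pcat p q) = (psrc p, parr p ++ parr q).
Proof.
move=> pq; apply: insubdK; rewrite unfold_in /= walk_cat (pvalP p).
by rewrite [walk_end _ _]pq (pvalP q).
Qed.

Lemma psrc_pcat p q : ptgt p = psrc q -> psrc (pcat p q) = psrc p.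
Proof. by move=> /pval_pcat e; rewrite /psrc e. Qed.

Lemma ptgt_pcat p q : ptgt p = psrc q -> ptgt (pcat p q) = ptgt q.
Proof.
move=> pq; rewrite /ptgt /psrc /parr (pval_pcat pq) /= walk_end_cat.
by rewrite [walk_end (psrc p) _]pq.
Qed.

Lemma pcatA p q r : ptgt p = psrc q -> ptgt q = psrc r ->
  pcat p (pcat q r) = pcat (pcat p q) r.
Proof.
move=> pq qr; apply: val_inj => /=.
rewrite !pval_pcat ?psrc_pcat ?ptgt_pcat //.
by rewrite /parr !pval_pcat //= catA.
Qed.

Lemma pcat1p p : pcat (ptriv (psrc p)) p = p.
Proof. by apply: val_inj => /=; rewrite pval_pcat //=; case: p => [[]]. Qed.

Lemma pcatp1 p : pcat p (ptriv (ptgt p)) = p.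
Proof.
by apply: val_inj => /=; rewrite pval_pcat //= cats0; case: p => [[]].
Qed.

End Paths.

Section LinearExtension.
Variables (k : comNzRingType) (K : choiceType) (V : lmodType k).
Implicit Types (F : K -> V) (x y : {malg k[K]}).

Definition lext F x : V := \sum_(p <- msupp x) x@_p *: F p.

Lemma lextEw F x (d : {fset K}) : (msupp x `<=` d)%fset ->
  lext F x = \sum_(p <- d) x@_p *: F p.
Proof.
move=> le_d; rewrite /lext (big_fset_incl _ le_d) // => p _ /mcoeff_outdom ->.
by rewrite scale0r.
Qed.

Lemma lext_is_linear F : linear (lext F).
Proof.
move=> c x y; pose d := (msupp x `|` msupp y `|` msupp (c *: x + y))%fset.
rewrite (@lextEw _ _ d) ?fsubsetUr // (@lextEw _ x d); last first.
  by rewrite /d -fsetUA fsubsetUl.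
rewrite (@lextEw _ y d); last by rewrite /d fsetUAC fsubsetUr.
rewrite scaler_sumr -big_split /=; apply: eq_bigr => p _.
by rewrite mcoeffD mcoeffZ scalerDl scalerA.
Qed.

HB.instance Definition _ F :=
  GRing.isLinear.Build k {malg k[K]} V *:%R (lext F) (lext_is_linear F).

Lemma lextU F p : lext F << p >> = F p.
Proof. by rewrite /lext msuppU oner_eq0 big_seq_fset1 mcoeffUU scale1r. Qed.

Lemma malg_lin_ext (g h : {malg k[K]} -> V) : linear g -> linear h ->
  (forall p, g << p >> = h << p >>) -> g =1 h.
Proof.
move=> lg lh gh x.
pose gL := HB.pack_for {linear {malg k[K]} -> V} g
  (GRing.isLinear.Build k {malg k[K]} V *:%R g lg).
pose hL := HB.pack_for {linear {malg k[K]} -> V} h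
  (GRing.isLinear.Build k {malg k[K]} V *:%R h lh).
rewrite -[g]/(gL : _ -> _) -[h]/(hL : _ -> _) (monalgE x) !linear_sum.
apply: eq_bigr => p _.
have -> : << x@_p *g p >> = x@_p *: << p >> :> {malg k[K]}.
  by apply/malgP => q; rewrite mcoeffZ !mcoeffU mulrnAr mulr1.
by rewrite !linearZ /= gh.
Qed.

End LinearExtension.

Section PathAlgebraType.
Variables (k : comNzRingType) (Q : quiver).

Definition pathalg : Type := {malg k[qpath Q]}.

HB.instance Definition _ := GRing.Lmodule.on pathalg.

End PathAlgebraType.

(* The locks only keep unification from unfolding the free module. *)
HB.lock Definition pvec (k : comNzRingType) (Q : quiver) (p : qpath Q) :
  pathalg k Q := << p >>.

Definition pmul (k : comNzRingType) (Q : quiver) (p q : qpath Q) :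
    pathalg k Q :=
  if ptgt p == psrc q then pvec k (pcat p q) else 0.

HB.lock Definition pathalg_mul (k : comNzRingType) (Q : quiver)
    (x y : pathalg k Q) : pathalg k Q :=
  lext (fun p => lext (fun q => pmul k p q) y) x.

Section PathAlgebra.
Variables (k : comNzRingType) (Q : quiver).
Local Notation pathalg := (pathalg k Q).
Local Notation pvec := (@pvec k Q).
Local Notation pmul := (@pmul k Q).
Local Notation pathalg_mul := (@pathalg_mul k Q).
Implicit Types (p q r : qpath Q) (x y z : pathalg).

Lemma pvecE p : pvec p = << p >>.
Proof. by rewrite pvec.unlock. Qed.

Lemma pathalg_lin_ext (g h : pathalg -> pathalg) : linear g -> linear h ->
  (forall p, g (pvec p) = h (pvec p)) -> g =1 h.
Proof.
by move=> lg lh gh; apply: malg_lin_ext => // p; rewrite -pvecE; apply: gh.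
Qed.

Lemma pathalg_mulE x y :
  pathalg_mul x y = lext (fun p => lext (fun q => pmul p q) y) x.
Proof. by rewrite pathalg_mul.unlock. Qed.

Definition pathalg_one : pathalg := \sum_(v : vert Q) pvec (ptriv v).

Lemma pathalg_mulUl p y : pathalg_mul (pvec p) y = lext (pmul p) y.
Proof. by rewrite pathalg_mulE pvecE lextU. Qed.

Lemma pathalg_mulUU p q : pathalg_mul (pvec p) (pvec q) = pmul p q.
Proof. by rewrite pathalg_mulUl pvecE lextU. Qed.

Lemma pathalg_mulPl c u v y :
  pathalg_mul (c *: u + v) y = c *: pathalg_mul u y + pathalg_mul v y.
Proof. by rewrite !pathalg_mulE; apply: lext_is_linear. Qed.

Lemma pathalg_mulPr x c y z :
  pathalg_mul x (c *: y + z) = c *: pathalg_mul x y + pathalg_mul x z.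
Proof.
rewrite !pathalg_mulE /lext scaler_sumr -big_split /=.
apply: eq_bigr => p _; rewrite -!/(lext _ _) lext_is_linear scalerDr !scalerA.
by rewrite mulrC.
Qed.

Lemma pathalg_mul0x y : pathalg_mul 0 y = 0.
Proof. by rewrite pathalg_mulE; apply: linear0. Qed.

Lemma pathalg_mulx0 x : pathalg_mul x 0 = 0.
Proof. by have:= pathalg_mulPr x (- 1) 0 0; rewrite !scaleN1r !addNr. Qed.

Lemma pathalg_mulDl : left_distributive pathalg_mul +%R.
Proof. by move=> x y z; have:= pathalg_mulPl 1 x y z; rewrite !scale1r. Qed.

Lemma pathalg_mulDr : right_distributive pathalg_mul +%R.
Proof. by move=> x y z; have:= pathalg_mulPr x 1 y z; rewrite !scale1r. Qed.

Lemma pathalg_mulUUU p q r :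
  pathalg_mul (pvec p) (pathalg_mul (pvec q) (pvec r)) =
  pathalg_mul (pathalg_mul (pvec p) (pvec q)) (pvec r).
Proof.
rewrite (pathalg_mulUU p q) (pathalg_mulUU q r) [pmul p q]/Defs.pmul [pmul q r]/Defs.pmul.
have [qr|qr] := eqVneq (ptgt q) (psrc r); last first.
  rewrite pathalg_mulx0; have [pq|pq] := eqVneq (ptgt p) (psrc q).
    by rewrite pathalg_mulUU /Defs.pmul ptgt_pcat // (negPf qr).
  by rewrite pathalg_mul0x.
rewrite (pathalg_mulUU p) /Defs.pmul psrc_pcat //.
have [pq|pq] := eqVneq (ptgt p) (psrc q).
  by rewrite pathalg_mulUU /Defs.pmul ptgt_pcat // qr eqxx pcatA.
by rewrite pathalg_mul0x.
Qed.

Lemma pathalg_mulA : associative pathalg_mul.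
Proof.
move=> x y z; move: x; apply: pathalg_lin_ext => [c u v|c u v|p].
- by rewrite pathalg_mulPl.
- by rewrite (pathalg_mulPl c u v y) pathalg_mulPl.
move: y; apply: pathalg_lin_ext => [c u v|c u v|q].
- by rewrite (pathalg_mulPl c u v z) pathalg_mulPr.
- by rewrite pathalg_mulPr pathalg_mulPl.
move: z; apply: pathalg_lin_ext => [c u v|c u v|r].
- by rewrite (pathalg_mulPr (pvec q)) (pathalg_mulPr (pvec p)).
- by rewrite pathalg_mulPr.
exact: pathalg_mulUUU.
Qed.

Lemma pathalg_mul1x : left_id pathalg_one pathalg_mul.
Proof.
apply: pathalg_lin_ext => [c u v|c u v|p] //; first by rewrite pathalg_mulPr.
rewrite /pathalg_one.
rewrite (big_morph (pathalg_mul^~ (pvec p)) (fun x y => pathalg_mulDl x y _)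
          (pathalg_mul0x _)).
rewrite (bigD1 (psrc p)) //= pathalg_mulUU /Defs.pmul eqxx pcat1p.
rewrite big1 ?addr0 // => v vp.
by rewrite pathalg_mulUU /Defs.pmul (negPf vp).
Qed.

Lemma pathalg_mulx1 : right_id pathalg_one pathalg_mul.
Proof.
apply: pathalg_lin_ext => [c u v|c u v|p] //; first by rewrite pathalg_mulPl.
rewrite /pathalg_one.
rewrite (big_morph (pathalg_mul (pvec p)) (pathalg_mulDr _) (pathalg_mulx0 _)).
rewrite (bigD1 (ptgt p)) //= pathalg_mulUU /Defs.pmul eqxx pcatp1.
rewrite big1 ?addr0 // => v vp.
by rewrite pathalg_mulUU /Defs.pmul eq_sym (negPf vp).
Qed.

HB.instance Definition _ := GRing.Zmodule_isPzRing.Build pathalg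
  pathalg_mulA pathalg_mul1x pathalg_mulx1 pathalg_mulDl pathalg_mulDr.

Lemma pathalg_scaleAl c (x y : pathalg) : c *: (x * y) = c *: x * y.
Proof. by rewrite -[c *: x]addr0 [RHS]pathalg_mulPl pathalg_mul0x addr0. Qed.

Lemma pathalg_scaleAr c (x y : pathalg) : c *: (x * y) = x * (c *: y).
Proof.
apply: esym; rewrite -[c *: y]addr0; apply: etrans (pathalg_mulPr x c y 0) _.
by rewrite (pathalg_mulx0 x) addr0.
Qed.

End PathAlgebra.

Section Ideals.
Variable R : pzRingType.

Definition is_ideal (J : set R) : Prop :=
  [/\ J 0,
      forall x y, J x -> J y -> J (x + y),
      forall a x, J x -> J (a * x)
    & forall a x, J x -> J (x * a)].

Record ideal := Ideal {
  ideal_set :> set R;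
  idealP : is_ideal ideal_set }.

Section IdealTheory.
Variable J : ideal.

Lemma ideal0 : ideal_set J 0.
Proof. by case: (idealP J). Qed.

Lemma idealD x y : ideal_set J x -> ideal_set J y -> ideal_set J (x + y).
Proof. by case: (idealP J) => _ JD _ _; apply: JD. Qed.

Lemma idealMl a x : ideal_set J x -> ideal_set J (a * x).
Proof. by case: (idealP J) => _ _ JM _; apply: JM. Qed.

Lemma idealMr a x : ideal_set J x -> ideal_set J (x * a).
Proof. by case: (idealP J) => _ _ _ JM; apply: JM. Qed.

Lemma idealN x : ideal_set J x -> ideal_set J (- x).
Proof. by move=> Jx; rewrite -mulN1r; apply: idealMl. Qed.

End IdealTheory.

Lemma smallest_is_ideal (S : set R) : is_ideal (smallest is_ideal S).
Proof.
split.
- by move=> J [[J0 _ _ _] _].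
- move=> x y Sx Sy J JS; case: (JS) => -[_ JD _ _] _.
  by apply: JD; [apply: Sx | apply: Sy].
- by move=> a x Sx J JS; case: (JS) => -[_ _ JM _] _; apply: JM; apply: Sx.
- by move=> a x Sx J JS; case: (JS) => -[_ _ _ JM] _; apply: JM; apply: Sx.
Qed.

Definition ideal_gen (S : set R) : ideal := Ideal (smallest_is_ideal S).

Definition ideal_mul (I J : ideal) : ideal :=
  ideal_gen [set x * y | x in I & y in J].

Definition ideal_exp (I : ideal) (n : nat) : ideal :=
  iter n (ideal_mul I) (ideal_gen setT).

Definition is_right_ideal (J : set R) : Prop :=
  [/\ J 0,
      forall x y, J x -> J y -> J (x + y)
    & forall a x, J x -> J (x * a)].

Definition is_maximal_right_ideal (J : set R) : Prop :=
  [/\ is_right_ideal J,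
      J <> setT
    & forall K, is_right_ideal K -> J `<=` K -> K = J \/ K = setT].

Definition jacobson : set R :=
  \bigcap_(J in [set J | is_maximal_right_ideal J]) J.

End Ideals.

Arguments jacobson R : clear implicits.

Lemma idealZ (k : comNzRingType) (Q : quiver) (J : ideal (pathalg k Q)) c x :
  ideal_set J x -> ideal_set J (c *: x).
Proof. by move=> Jx; rewrite -[x]mul1r pathalg_scaleAl; apply: idealMl. Qed.

Section AdmissibleIdeal.
Variables (k : comNzRingType) (Q : quiver).

Definition arrow_ideal : ideal (pathalg k Q) :=
  ideal_gen [set pvec k (parrow a) | a in [set: arr Q]].

Definition admissible (I : ideal (pathalg k Q)) : Prop :=
  (exists2 n, (2 <= n)%N & ideal_exp arrow_ideal n `<=` I) /\
  I `<=` ideal_exp arrow_ideal 2.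

End AdmissibleIdeal.

Section Quotient.
Variables (k : comNzRingType) (Q : quiver) (I : ideal (pathalg k Q)).
Local Notation B := (pathalg k Q).

Local Notation J := (ideal_set I).

Definition ideal_eq (x y : B) : bool := `[< J (x - y) >].

Lemma ideal_eq_equiv : equiv_class_of ideal_eq.
Proof.
split=> [x|x y|y x z]; rewrite /ideal_eq.
- by apply/asboolP; rewrite subrr; apply: ideal0.
- by apply/asboolP/asboolP => /idealN; rewrite opprB.
- move=> /asboolP xy /asboolP yz; apply/asboolP.
  by rewrite -(subrKA y); apply: idealD.
Qed.

Canonical ideal_eq_rel := EquivRelPack ideal_eq_equiv.

Definition quot : Type := {eq_quot ideal_eq_rel}.

HB.instance Definition _ := Choice.on quot.
HB.instance Definition _ := EqQuotient.on quot.

Definition cls (x : B) : quot := \pi_quot x.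

Lemma clsP x y : cls x = cls y <-> J (x - y).
Proof.
split=> [/eqmodP|xy]; first by move=> /asboolP.
by apply/eqmodP/asboolP.
Qed.

Lemma cls_repr u : cls (repr u) = u. Proof. exact: reprK. Qed.

Lemma repr_cls x : J (repr (cls x) - x).
Proof. by apply/clsP; rewrite cls_repr. Qed.

End Quotient.

HB.lock Definition quot_add (k : comNzRingType) (Q : quiver)
  (I : ideal (pathalg k Q)) (u v : quot I) : quot I := cls I (repr u + repr v).
HB.lock Definition quot_opp (k : comNzRingType) (Q : quiver)
  (I : ideal (pathalg k Q)) (u : quot I) : quot I := cls I (- repr u).
HB.lock Definition quot_mul (k : comNzRingType) (Q : quiver)
  (I : ideal (pathalg k Q)) (u v : quot I) : quot I := cls I (repr u * repr v).
HB.lock Definition quot_scale (k : comNzRingType) (Q : quiver)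
  (I : ideal (pathalg k Q)) (c : k) (u : quot I) : quot I := cls I (c *: repr u).

Section QuotientAlgebra.
Variables (k : comNzRingType) (Q : quiver) (I : ideal (pathalg k Q)).
Local Notation B := (pathalg k Q).
Local Notation J := (ideal_set I).
Local Notation quot := (quot I).
Local Notation cls := (cls I).
Local Notation quot_add := (@quot_add k Q I).
Local Notation quot_opp := (@quot_opp k Q I).
Local Notation quot_mul := (@quot_mul k Q I).
Local Notation quot_scale := (@quot_scale k Q I).
Implicit Types (x y : B) (u v w : quot).

Lemma cls_addE x y : quot_add (cls x) (cls y) = cls (x + y).
Proof.
rewrite quot_add.unlock; apply/clsP; rewrite opprD addrACA.
by apply: idealD; apply: repr_cls.
Qed.

Lemma cls_oppE x : quot_opp (cls x) = cls (- x).
Proof.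
by rewrite quot_opp.unlock; apply/clsP; rewrite -opprD; apply/idealN/repr_cls.
Qed.

Lemma cls_mulE x y : quot_mul (cls x) (cls y) = cls (x * y).
Proof.
rewrite quot_mul.unlock; apply/clsP.
rewrite -(subrKA (x * repr (cls y))) -mulrBl -mulrBr.
by apply: idealD; [apply: idealMr | apply: idealMl]; apply: repr_cls.
Qed.

Lemma cls_scaleE c x : quot_scale c (cls x) = cls (c *: x).
Proof.
rewrite quot_scale.unlock; apply/clsP; rewrite -scalerBr.
by apply/idealZ/repr_cls.
Qed.

Lemma quot_addA : associative quot_add.
Proof.
move=> u v w; rewrite -(cls_repr u) -(cls_repr v) -(cls_repr w).
by rewrite !cls_addE addrA.
Qed.
Lemma quot_addC : commutative quot_add.
Proof. by move=> u v; rewrite quot_add.unlock addrC. Qed.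
Lemma quot_add0 : left_id (cls 0) quot_add.
Proof. by move=> u; rewrite -(cls_repr u) cls_addE add0r. Qed.
Lemma quot_addN : left_inverse (cls 0) quot_opp quot_add.
Proof. by move=> u; rewrite -(cls_repr u) cls_oppE cls_addE addNr. Qed.

HB.instance Definition _ :=
  GRing.isZmodule.Build quot quot_addA quot_addC quot_add0 quot_addN.

Lemma clsD : {morph cls : x y / x + y}.
Proof. by move=> x y; rewrite -cls_addE. Qed.

Lemma quot_mulA : associative quot_mul.
Proof.
move=> u v w; rewrite -(cls_repr u) -(cls_repr v) -(cls_repr w).
by rewrite !cls_mulE mulrA.
Qed.
Lemma quot_mul1x : left_id (cls 1) quot_mul.
Proof. by move=> u; rewrite -(cls_repr u) cls_mulE mul1r. Qed.
Lemma quot_mulx1 : right_id (cls 1) quot_mul.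
Proof. by move=> u; rewrite -(cls_repr u) cls_mulE mulr1. Qed.
Lemma quot_mulDl : left_distributive quot_mul +%R.
Proof.
move=> u v w; rewrite -(cls_repr u) -(cls_repr v) -(cls_repr w).
by rewrite -clsD !cls_mulE -clsD mulrDl.
Qed.
Lemma quot_mulDr : right_distributive quot_mul +%R.
Proof.
move=> u v w; rewrite -(cls_repr u) -(cls_repr v) -(cls_repr w).
by rewrite -clsD !cls_mulE -clsD mulrDr.
Qed.

HB.instance Definition _ := GRing.Zmodule_isPzRing.Build quot
  quot_mulA quot_mul1x quot_mulx1 quot_mulDl quot_mulDr.

Lemma quot_scaleA c d u :
  quot_scale c (quot_scale d u) = quot_scale (c * d) u.
Proof. by rewrite -(cls_repr u) !cls_scaleE scalerA. Qed.
Lemma quot_scale1 : left_id 1 quot_scale.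
Proof. by move=> u; rewrite -(cls_repr u) cls_scaleE scale1r. Qed.
Lemma quot_scaleDr : right_distributive quot_scale +%R.
Proof.
move=> c u v; rewrite -(cls_repr u) -(cls_repr v).
by rewrite -clsD !cls_scaleE -clsD scalerDr.
Qed.
Lemma quot_scaleDl u : {morph quot_scale^~ u : c d / c + d}.
Proof.
by move=> c d; rewrite -(cls_repr u) !cls_scaleE -clsD scalerDl.
Qed.

HB.instance Definition _ := GRing.Zmodule_isLmodule.Build k quot
  quot_scaleA quot_scale1 quot_scaleDr quot_scaleDl.

Lemma cls_is_linear : linear cls.
Proof. by move=> c x y; rewrite clsD -cls_scaleE. Qed.

HB.instance Definition _ :=
  GRing.isLinear.Build k B quot *:%R cls cls_is_linear.

Lemma cls_is_monoid_morphism : monoid_morphism cls.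
Proof. by split=> // x y; rewrite -cls_mulE. Qed.

HB.instance Definition _ :=
  GRing.isMonoidMorphism.Build B quot cls cls_is_monoid_morphism.

End QuotientAlgebra.

Section Presentation.
Variables (k : comNzRingType) (Q : quiver) (I : ideal (pathalg k Q)).
Local Notation A := (quot I).

Definition pcls (p : qpath Q) : A := cls I (pvec k p).

(* The classes of the members of P, as a family, form a k-basis of A. *)
Definition path_basis (P : {fset qpath Q}) : Prop :=
  (forall c : qpath Q -> k, \sum_(p <- P) c p *: pcls p = 0 ->
     forall p, p \in P -> c p = 0) /\
  (forall a : A, exists c : qpath Q -> k, a = \sum_(p <- P) c p *: pcls p).

Definition relation (rho : pathalg k Q) : Prop :=
  rho != 0 /\
  exists i j, forall p, p \in msupp rho ->
    [/\ (2 <= plen p)%N, psrc p = i & ptgt p = j].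

Definition has_target (rho : pathalg k Q) (j : vert Q) : Prop :=
  forall p, p \in msupp rho -> ptgt p = j.

(* E, the span in A of the classes of the trivial paths. *)
Definition vert_span : set A :=
  [set a | exists c : vert Q -> k, a = \sum_i c i *: pcls (ptriv i)].

(* An E-bimodule map rad A (x)_E rad A -> A, extended by zero to a k-bilinear
   map on A, which is a Hochschild 2-cocycle. A map on the tensor product over
   E is given by the E-balanced map a, b |-> f (a (x) b). *)
Record cocycle := Cocycle {
  cfun :> A -> A -> A;
  cocycle_bilinear : bilinear_for *:%R *:%R cfun;
  cocycle_El : forall e a, vert_span e -> cfun e a = 0;
  cocycle_Er : forall e a, vert_span e -> cfun a e = 0;
  cocycle_balanced : forall e a b,
    vert_span e -> jacobson A a -> jacobson A b ->
    cfun (a * e) b = cfun a (e * b);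
  cocycle_linl : forall e a b,
    vert_span e -> jacobson A a -> jacobson A b ->
    cfun (e * a) b = e * cfun a b;
  cocycle_linr : forall e a b,
    vert_span e -> jacobson A a -> jacobson A b ->
    cfun a (b * e) = cfun a b * e;
  cocycle_eq : forall a0 a1 a2 : A,
    a0 * cfun a1 a2 + cfun a0 (a1 * a2) = cfun (a0 * a1) a2 + cfun a0 a1 * a2 }.

(* The image of f on rad A (x)_E rad A: finite sums, as elements of a tensor
   product are finite sums of pure tensors. *)
Definition cocycle_im (f : cocycle) : set A :=
  [set y | exists s : seq (A * A),
     (forall u, u \in s -> jacobson A u.1 /\ jacobson A u.2) /\
     y = \sum_(u <- s) f u.1 u.2].

(* With bs`_i the class of alpha_(i.+1) (indices start at 0); the sum is
   empty for a path of length at most 1. *)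
Definition fhat_path (f : cocycle) (p : qpath Q) : A :=
  let bs := [seq pcls (parrow a) | a <- parr p] in
  \sum_(1 <= i < size bs)
     f (\prod_(b <- take i bs) b) bs`_i * \prod_(b <- drop i.+1 bs) b.

Definition fhat (f : cocycle) (x : pathalg k Q) : A := lext (fhat_path f) x.

End Presentation.

(* The underlying module does not depend on f; the product below does. *)
Definition ext (k : comNzRingType) (Q : quiver) (I : ideal (pathalg k Q))
  (f : cocycle I) : Type := (quot I * quot I)%type.

Section Extension.
Variables (k : comNzRingType) (Q : quiver) (I : ideal (pathalg k Q)).
Variable f : cocycle I.
Local Notation ext := (ext f).

HB.instance Definition _ := GRing.Lmodule.on ext.

Definition ext_one : ext := (1, 0).
Definition ext_mul (x y : ext) : ext :=
  (x.1 * y.1, x.1 * y.2 + x.2 * y.1 + f x.1 y.1).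

Lemma vert_span1 : @vert_span k Q I 1.
Proof.
exists (fun=> 1); rewrite -(rmorph1 (cls I)) raddf_sum /=.
by apply: eq_bigr => i _; rewrite scale1r.
Qed.

Lemma cocycleDl a b c : f (a + b) c = f a c + f b c.
Proof.
by have [/(_ c 1 a b)] := cocycle_bilinear f; rewrite /= !scale1r.
Qed.

Lemma cocycleDr a b c : f a (b + c) = f a b + f a c.
Proof.
by have [_ /(_ a 1 b c)] := cocycle_bilinear f; rewrite /= !scale1r.
Qed.

Lemma ext_mulA : associative ext_mul.
Proof.
move=> [a0 b0] [a1 b1] [a2 b2]; congr (_, _); first exact: mulrA.
rewrite /= !mulrDr !mulrDl !mulrA -!addrA; congr (_ + (_ + _)).
by rewrite addrCA (addrC (f a0 a1 * a2)) cocycle_eq.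
Qed.

Lemma ext_mul1x : left_id ext_one ext_mul.
Proof.
move=> [a b]; rewrite /ext_mul /= (cocycle_El f _ vert_span1).
by rewrite !mul1r mul0r !addr0.
Qed.

Lemma ext_mulx1 : right_id ext_one ext_mul.
Proof.
move=> [a b]; rewrite /ext_mul /= (cocycle_Er f _ vert_span1).
by rewrite !mulr1 mulr0 add0r addr0.
Qed.

Lemma ext_mulDl : left_distributive ext_mul +%R.
Proof.
move=> [a b] [a' b'] [c d]; congr (_, _); first exact: mulrDl.
by rewrite /= cocycleDl !mulrDl (addrACA (a * d)) [LHS]addrACA.
Qed.

Lemma ext_mulDr : right_distributive ext_mul +%R.
Proof.
move=> [a b] [a' b'] [c d]; congr (_, _); first exact: mulrDr.
by rewrite /= cocycleDr !mulrDr (addrACA (a * b')) [LHS]addrACA.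
Qed.

HB.instance Definition _ := GRing.Zmodule_isPzRing.Build ext
  ext_mulA ext_mul1x ext_mulx1 ext_mulDl ext_mulDr.

End Extension.

Section ExtensionQuiver.
Variables (k : comNzRingType) (Q : quiver) (I : ideal (pathalg k Q)).
Variable f : cocycle I.

(* The vertices i with e_i not in Im f; they index the added loops. *)
Definition loop_index : finType :=
  {i : vert Q | `[< ~ cocycle_im f (pcls I (ptriv i)) >]}.

Definition quiver_f : quiver := {|
  vert := vert Q;
  arr := (arr Q + loop_index)%type;
  src := fun b => match b with inl a => src a | inr i => val i end;
  tgt := fun b => match b with inl a => tgt a | inr i => val i end |}.

Definition hat_arrow (a : arr Q) : arr quiver_f := inl a.
Definition loop_arrow (i : loop_index) : arr quiver_f := inr i.

Lemma walk_hat (v : vert Q) (s : seq (arr Q)) :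
  walk v s -> @walk quiver_f v (map hat_arrow s).
Proof. by elim: s v => //= a s IHs v /andP[-> /IHs]. Qed.

Definition hat_path (p : qpath Q) : qpath quiver_f :=
  @QPath quiver_f (psrc p, map hat_arrow (parr p)) (walk_hat (pvalP p)).

Definition hat (x : pathalg k Q) : pathalg k quiver_f :=
  lext (fun p => pvec k (hat_path p)) x.

Section IdealF.
Variables (Gamma : {fset pathalg k Q}) (w : pathalg k Q -> pathalg k Q).
Variable mu : vert Q -> pathalg k Q -> k.

Definition eps (i : vert Q) : pathalg k quiver_f :=
  if insub i is Some u then pvec k (parrow (loop_arrow u))
  else \sum_(rho <- Gamma) mu i rho *: hat rho.

Definition gen_f : set (pathalg k quiver_f) :=
  [set x | [\/ exists i : vert Q, x = eps i ^+ 2,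
               exists a : arr Q,
                 x = eps (src a) * hat (pvec k (parrow a))
                     - hat (pvec k (parrow a)) * eps (tgt a)
             | exists rho j, [/\ rho \in Gamma, has_target rho j
                 & x = hat rho - hat (w rho) * eps j]]].

Definition ideal_f : ideal (pathalg k quiver_f) := ideal_gen gen_f.

End IdealF.
End ExtensionQuiver.

Arguments gen_f {k Q I} f Gamma w mu.
Arguments ideal_f {k Q I} f Gamma w mu.

(* Main.v *)
(* Sending hat(alpha) to (alpha, 0) and the loop at i to (0, e_i) defines a
   surjective morphism kQ_f -> A_f with hat(x) |-> (x, fhat(x)) and
   eps_i |-> (0, e_i), so that eta, the sum of the eps_i, goes to (0, 1); it
   kills I_f. For the kernel: modulo I_f the element eta is central of square
   zero, hence every element is congruent to some hat(u) + hat(v) eta, and for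
   x in I one has hat(x) = hat(y) eta for a suitable y. If hat(u) + hat(v) eta
   is killed then u is in I, so the element is congruent to some hat(y) eta; its
   image (0, y) vanishes, so y is in I and hat(y) eta is a multiple of
   eta^2 = 0. Admissibility of I serves only to put the trivial paths into the
   basis P, and P only to show that eps_i is supported at the vertex i. *)
Require Import Defs.
From HB Require Import structures.
From mathcomp Require Import all_boot all_order all_algebra.
From mathcomp Require Import finmap.
From mathcomp.multinomials Require Import monalg.
From mathcomp Require Import boolp classical_sets.

Set Implicit Arguments.
Unset Strict Implicit.
Unset Printing Implicit Defensive.

Import GRing.Theory.

Local Open Scope classical_set_scope.
Local Open Scope ring_scope.

(** * Evaluation of paths in a ring with orthogonal vertex idempotents *)

Section PathEvaluation.
Variables (R : pzRingType) (Q : quiver) (E : vert Q -> R) (g : arr Q -> R).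

(** The leading factor makes a trivial path evaluate to its idempotent instead of 1. *)
Definition peval (p : qpath Q) : R := E (psrc p) * \prod_(a <- parr p) g a.

Hypothesis E_orth : forall u v, E u * E v = if u == v then E u else 0.
Hypothesis E_src : forall a, E (src a) * g a = g a.
Hypothesis E_tgt : forall a, g a * E (tgt a) = g a.

Lemma walk_mul_end v s : walk v s ->
  E v * \prod_(a <- s) g a * E (walk_end v s) = E v * \prod_(a <- s) g a.
Proof.
elim: s v => [|a s IHs] v /=.
  by rewrite big_nil mulr1 /walk_end /= E_orth eqxx.
(* [E_tgt] inserts the idempotent at the target of [a], with which the induction hypothesis
   begins. *)
move=> /andP[/eqP <- /IHs]; rewrite big_cons !mulrA E_src -(E_tgt a).
by rewrite -!mulrA => IH; congr (_ * _); rewrite mulrA in IH; rewrite mulrA.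
Qed.

(** Inserting the idempotent at the end of [p] puts two idempotents side by side, and orthogonality
    decides whether the paths compose. *)
Lemma peval_mul p q :
  peval p * peval q = if ptgt p == psrc q then peval (pcat p q) else 0.
Proof.
have pE : peval p * E (ptgt p) = peval p by apply: walk_mul_end (pvalP p).
rewrite -pE {2}/peval mulrA -(mulrA (peval p)) E_orth.
case: eqP => [pq|_]; last by rewrite mulr0 mul0r.
rewrite pE /peval -mulrA -big_cat /=.
by rewrite /psrc /parr pval_pcat.
Qed.

End PathEvaluation.

Lemma ideal_gen_sub (R : pzRingType) (S J : set R) :
  is_ideal J -> S `<=` J -> ideal_gen S `<=` J.
Proof. by move=> idJ SJ x; apply. Qed.

Lemma sub_ideal_gen (R : pzRingType) (S : set R) : S `<=` ideal_gen S.
Proof. by move=> x Sx J [_]; apply. Qed.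

(** * Path algebras: bilinear extension, trivial paths, targets, bases of paths *)

Section PathAlgebraTheory.
Variables (k : comNzRingType) (Q : quiver).
Local Notation B := (pathalg k Q).
Implicit Types (p q : qpath Q) (x y : B).

Lemma pathalg_ext (V : lmodType k) (g h : B -> V) : linear g -> linear h ->
  (forall p, g (pvec k p) = h (pvec k p)) -> g =1 h.
Proof.
by move=> lg lh gh; apply: malg_lin_ext => // p; rewrite -pvecE; apply: gh.
Qed.

Lemma lext_pvec (V : lmodType k) (F : qpath Q -> V) p : lext F (pvec k p) = F p.
Proof. by rewrite pvecE lextU. Qed.

Lemma pathalg_expand x : x = \sum_(p <- msupp x) x@_p *: pvec k p.
Proof.
apply: (@pathalg_ext _ id (lext (fun p => pvec k p))) => // [|p].
  exact: lext_is_linear.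
by rewrite lext_pvec.
Qed.

Lemma pathalg_mulr_linear x : linear (fun y : B => x * y).
Proof. exact: pathalg_mulPr. Qed.

Lemma pathalg_mull_linear y : linear (fun x : B => x * y).
Proof. by move=> c u v; apply: pathalg_mulPl. Qed.

Lemma pvecM p q : pvec k p * pvec k q = pmul k p q.
Proof. exact: pathalg_mulUU. Qed.

(** Both sides are bilinear, so pairs of paths suffice. An arbitrary bilinear [m] covers
    coefficients in [k] as well as products of algebras. *)
Lemma lext_mul (V : lmodType k) (m : V -> V -> V) (F : qpath Q -> V) :
    (forall v, linear (m v)) -> (forall v, linear (m^~ v)) ->
    (forall p q, m (F p) (F q) = lext F (pmul k p q)) ->
  forall x y, lext F (x * y : B) = m (lext F x) (lext F y).
Proof.
move=> linr linl mF x y.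
apply: (@pathalg_ext V (fun z : B => lext F (z * y : B))
  (fun z : B => m (lext F z) (lext F y))) x => [c u v|c u v|p].
- by rewrite pathalg_mull_linear lext_is_linear.
- by rewrite lext_is_linear; apply: linl.
apply: (@pathalg_ext V (fun z : B => lext F (pvec k p * z : B))
  (fun z : B => m (lext F (pvec k p)) (lext F z))) y => [c u v|c u v|q].
- by rewrite pathalg_mulr_linear lext_is_linear.
- by rewrite lext_is_linear; apply: linr.
by rewrite pvecM !lext_pvec mF.
Qed.

(** In this form a mere ring morphism can be applied to a scalar multiple. *)
Lemma pathalg_scaleE c x : c *: x = c *: (1 : B) * x.
Proof. by rewrite -pathalg_scaleAl mul1r. Qed.

Lemma pathalg1 : 1 = \sum_v pvec k (ptriv v) :> B.
Proof. by []. Qed.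

Lemma triv_orth (u v : vert Q) :
  pvec k (ptriv u) * pvec k (ptriv v) =
    if u == v then pvec k (ptriv u) else 0.
Proof.
rewrite pvecM /pmul -[ptgt _]/u -[psrc _]/v.
by case: eqVneq => // ->; rewrite (pcat1p (ptriv v)).
Qed.

Lemma triv_arrow (a : arr Q) :
  pvec k (ptriv (src a)) * pvec k (parrow a) = pvec k (parrow a).
Proof. by rewrite pvecM /pmul eqxx (pcat1p (parrow a)). Qed.

Lemma arrow_triv (a : arr Q) :
  pvec k (parrow a) * pvec k (ptriv (tgt a)) = pvec k (parrow a).
Proof. by rewrite pvecM /pmul eqxx (pcatp1 (parrow a)). Qed.

Lemma pvec_prod p :
  pvec k p = peval (fun v => pvec k (ptriv v)) (fun a => pvec k (parrow a)) p.
Proof.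
case: p => [[v s] ws]; rewrite /peval /psrc /parr /=.
elim: s v ws => [|a s IHs] v ws.
  by rewrite big_nil mulr1; congr (pvec k _); apply: val_inj.
have /= /andP[/eqP av ws'] := ws; subst v.
rewrite big_cons mulrA triv_arrow -(arrow_triv a) -mulrA -(IHs _ ws').
rewrite pvecM /pmul eqxx; congr (pvec k _); apply: val_inj.
by rewrite /= pval_pcat.
Qed.

Lemma mul_triv_target x j b : has_target x j ->
  x * pvec k (ptriv b) = if j == b then x else 0.
Proof.
move=> xj; rewrite {1}(pathalg_expand x) mulr_suml.
rewrite (eq_big_seq (fun p => if j == b then x@_p *: pvec k p else 0)).
  by case: eqP => _; [rewrite -pathalg_expand | rewrite big1].
move=> p px; rewrite -pathalg_scaleAl pvecM /pmul (xj p px).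
rewrite -[psrc (ptriv b)]/b; have [<-|_] := eqVneq j b.
  by rewrite -(xj p px) pcatp1.
by rewrite scaler0.
Qed.

Lemma mul_triv_target_id x j : has_target x j -> x * pvec k (ptriv j) = x.
Proof. by move=> xj; rewrite (mul_triv_target _ xj) eqxx. Qed.

Lemma relation_target x : relation x -> exists j, has_target x j.
Proof. by case=> _ [i [j xij]]; exists j => p /xij[]. Qed.

(** For zero, [has_target] holds vacuously at every vertex; otherwise any path of the support
    decides. *)
Lemma has_target_inj x i j :
  x != 0 -> has_target x i -> has_target x j -> i = j.
Proof.
move=> x0 xi xj; have [p px] : exists p, p \in msupp x.
  apply: contrapT => no_p; case/eqP: x0; apply/malgP => p.
  rewrite mcoeff0 mcoeff_outdom //; apply/negP => px.
  by apply: no_p; exists p.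
by rewrite -(xi p px) (xj p px).
Qed.

(** A concatenation is trivial only if both factors are, so no other pair of paths contributes. *)
Lemma mcoeff_triv_mul v x y :
  (x * y : B)@_(ptriv v) = x@_(ptriv v) * y@_(ptriv v).
Proof.
(* The coefficient is the linear extension of an indicator function, with [k] seen as a module over
   itself. *)
pose F p : k^o := (p == ptriv v)%:R.
have E (z : B) : z@_(ptriv v) = lext F z.
  rewrite {1}(pathalg_expand z) raddf_sum /=; apply: eq_bigr => p _.
  by rewrite mcoeffZ pvecE mcoeffU.
rewrite !E (@lext_mul k^o *%R) // => [u c a b|u c a b|p q].
- by rewrite mulrDr scalerAr.
- by rewrite mulrDl scalerAl.
rewrite /pmul /F -natrM mulnb; case: ifPn => pq.
  rewrite pvecE lextU; congr (_ %:R); congr nat_of_bool.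
  apply/andP/eqP => [[/eqP -> /eqP ->]|]; first exact: (pcat1p (ptriv v)).
  move=> /(congr1 val); rewrite [val _]pval_pcat ?(eqP pq) //.
  case: p q pq => [[u [|a s]] ws] [[u' [|a' s']] ws'] //= /eqP pq [uv].
  by split; apply/eqP/val_inj; congr pair; rewrite /= -uv //; apply: esym pq.
rewrite linear0; case: (eqVneq p (ptriv v)) => //= p1.
by case: eqP => // q1; rewrite p1 q1 eqxx in pq.
Qed.

(** The kernel of the projection onto the span of the trivial paths. *)
Definition no_triv : set B := [set x | forall v, x@_(ptriv v) = 0].

Lemma no_triv_ideal : is_ideal no_triv.
Proof.
split=> [v|x y x0 y0 v|a x x0 v|a x x0 v]; first exact: mcoeff0.
- by rewrite mcoeffD x0 y0 addr0.
- by rewrite mcoeff_triv_mul x0 mulr0.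
- by rewrite mcoeff_triv_mul x0 mul0r.
Qed.

Lemma arrow_ideal_no_triv : arrow_ideal k Q `<=` no_triv.
Proof.
apply: (ideal_gen_sub no_triv_ideal) => _ [a _ <-] v.
by rewrite pvecE mcoeffU; case: eqP => // /(congr1 val).
Qed.

Lemma admissible_no_triv (I : ideal B) : admissible I -> I `<=` no_triv.
Proof.
move=> [_ sub] x /sub; apply: (ideal_gen_sub no_triv_ideal).
move=> _ [y /arrow_ideal_no_triv y0 [z _ <-]].
by case: no_triv_ideal => _ _ _; apply.
Qed.

(** Otherwise the trivial path minus its expansion over [P] would be an element of [I] with
    coefficient 1 at a trivial path. *)
Lemma triv_in_basis (I : ideal B) (P : {fset qpath Q}) v :
  admissible I -> path_basis I P -> ptriv v \in P.
Proof.
move=> /admissible_no_triv sub [_ /(_ (pcls I (ptriv v)))[c]].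
rewrite /pcls; under eq_bigr do rewrite -linearZ /=.
rewrite -raddf_sum => /clsP/sub/(_ v)/eqP.
rewrite mcoeffB pvecE mcoeffUU raddf_sum /= subr_eq0.
apply: contraTT => vP; rewrite big_seq big1 ?oner_eq0 // => p pP.
rewrite mcoeffZ pvecE mcoeffU; case: eqP => [pv|]; last by rewrite mulr0.
by rewrite -pv pP in vP.
Qed.

(** Lifts to the span of [P] are unique, which turns equalities in [A] into equalities in the path
    algebra. *)
Lemma basis_inj (I : ideal B) (P : {fset qpath Q}) x y : path_basis I P ->
  {subset msupp x <= P} -> {subset msupp y <= P} -> cls I x = cls I y -> x = y.
Proof.
move=> [free _] xP yP xy; apply/malgP => p.
have out (z : B) : {subset msupp z <= P} -> p \notin P -> z@_p = 0.
  by move=> zP pP; apply: mcoeff_outdom; apply: contra pP; apply: zP.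
have [pP|pP] := boolP (p \in P); last by rewrite !out.
have expand (z : B) : {subset msupp z <= P} ->
    cls I z = \sum_(q <- P) z@_q *: pcls I q.
  move=> /fsubsetP zP; rewrite {1}(pathalg_expand z) raddf_sum /=.
  rewrite (big_fset_incl _ zP) => [|q _ /mcoeff_outdom ->].
    by apply: eq_bigr => q _; rewrite linearZ.
  by rewrite scale0r raddf0.
apply/eqP; rewrite -subr_eq0; apply/eqP.
apply: (free (fun p => x@_p - y@_p)) pP.
under eq_bigr do rewrite scalerBl.
by rewrite sumrB -!expand // xy subrr.
Qed.

End PathAlgebraTheory.

Lemma prod_rcons (R : pzSemiRingType) (T : Type) (s : seq T) x (F : T -> R) :
  \prod_(i <- rcons s x) F i = (\prod_(i <- s) F i) * F x.
Proof. by rewrite -cats1 big_cat /= big_seq1. Qed.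

(** * Scalars in the quotient and the first isomorphism theorem *)

Section QuotientTheory.
Variables (k : comNzRingType) (Q : quiver) (I : ideal (pathalg k Q)).
Implicit Types (a b : quot I).

Lemma quot_scaleAl c a b : c *: (a * b) = c *: a * b.
Proof.
rewrite -(cls_repr a) -(cls_repr b) -rmorphM -!linearZ -rmorphM /=.
by rewrite pathalg_scaleAl.
Qed.

Lemma quot_scaleAr c a b : c *: (a * b) = a * (c *: b).
Proof.
rewrite -(cls_repr a) -(cls_repr b) -rmorphM -!linearZ -rmorphM /=.
by rewrite pathalg_scaleAr.
Qed.

Lemma cls_eq0 x : cls I x = 0 <-> ideal_set I x.
Proof. by rewrite -(raddf0 (cls I)) clsP subr0. Qed.

Lemma first_isomorphism (R : pzRingType) (F : {rmorphism pathalg k Q -> R}) :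
    (forall r, exists x, F x = r) -> (forall x, F x = 0 <-> ideal_set I x) ->
  exists2 phi : {rmorphism R -> quot I},
    forall x, phi (F x) = cls I x & bijective phi.
Proof.
move=> Fsurj Fker.
(* [sec] need not be additive or multiplicative, but two preimages of one element differ by an
   element of [I]. *)
have [sec secK] := choice Fsurj.
pose phi r := cls I (sec r).
have phiF x : phi (F x) = cls I x.
  by apply/clsP/Fker; rewrite rmorphB secK subrr.
have phiB : zmod_morphism phi.
  by move=> r s; rewrite -(secK r) -(secK s) -rmorphB !phiF rmorphB.
have phiM : monoid_morphism phi.
  split=> [|r s]; first by rewrite -(rmorph1 F) phiF rmorph1.
  by rewrite -(secK r) -(secK s) -rmorphM !phiF rmorphM.
pose phiA := GRing.isZmodMorphism.Build R (quot I) phi phiB.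
pose phiN := GRing.isMonoidMorphism.Build R (quot I) phi phiM.
pose phiR := HB.pack_for {rmorphism R -> quot I} phi phiA phiN.
exists phiR => //=.
exists (fun a => F (repr a)) => [r|a]; last by rewrite phiF cls_repr.
apply/eqP; rewrite -subr_eq0 -{2}(secK r) -rmorphB; apply/eqP/Fker.
exact: repr_cls.
Qed.

End QuotientTheory.

(** * The map [hat] as a morphism of rings and of modules *)

Section HatMorphism.
Variables (k : comNzRingType) (Q : quiver) (I : ideal (pathalg k Q)).
Variable f : cocycle I.
Local Notation hat := (hat f).

Lemma hat_linear : linear hat.
Proof. exact: lext_is_linear. Qed.

HB.instance Definition _ := GRing.isLinear.Build k (pathalg k Q)
  (pathalg k (quiver_f f)) *:%R hat hat_linear.

Lemma hat_pvec p : hat (pvec k p) = pvec k (hat_path f p).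
Proof. exact: lext_pvec. Qed.

Lemma ptgt_hat p : ptgt (hat_path f p) = ptgt p.
Proof. by rewrite /ptgt /walk_end -map_comp. Qed.

Lemma hatM : {morph hat : x y / x * y}.
Proof.
apply: (lext_mul (@pathalg_mulr_linear _ _) (@pathalg_mull_linear _ _)) => p q.
rewrite pvecM /pmul ptgt_hat -[psrc (hat_path f q)]/(psrc q).
case: eqP => pq; last by rewrite linear0.
rewrite lext_pvec; congr (pvec k _); apply: val_inj.
rewrite /= pval_pcat ?ptgt_hat // /psrc /parr pval_pcat //=.
by rewrite map_cat.
Qed.

Lemma hat1 : hat 1 = 1.
Proof.
rewrite !pathalg1 raddf_sum /=.
by apply: eq_bigr => v _; rewrite hat_pvec; congr (pvec k _); apply: val_inj.
Qed.

HB.instance Definition _ := GRing.isMonoidMorphism.Build (pathalg k Q)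
  (pathalg k (quiver_f f)) hat (hat1, hatM).

End HatMorphism.

(** * The evaluation morphism from the path algebra of [quiver_f] to [ext f] *)

Section ExtensionEvaluation.
Variables (k : comNzRingType) (Q : quiver) (I : ideal (pathalg k Q)).
Variable f : cocycle I.
Local Notation Qf := (quiver_f f).
Local Notation e v := (pcls I (ptriv v)).

Lemma vert_span_triv v : vert_span (e v).
Proof.
exists (fun u => (u == v)%:R); rewrite (bigD1 v) //= eqxx scale1r.
by rewrite big1 ?addr0 // => u /negPf ->; rewrite scale0r.
Qed.

Lemma cocycle_linear_l b : linear (f^~ b).
Proof. by case: (cocycle_bilinear f) => + _; apply. Qed.

Lemma cocycle_linear_r a : linear (f a).
Proof. by case: (cocycle_bilinear f) => _; apply. Qed.

Lemma cocycle0l b : f 0 b = 0.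
Proof. by apply: (addrI (f 0 b)); rewrite -cocycleDl !addr0. Qed.

Lemma cocycle0r a : f a 0 = 0.
Proof. by apply: (addrI (f a 0)); rewrite -cocycleDr !addr0. Qed.

Lemma cocycle_triv_l v b : f (e v) b = 0.
Proof. exact: cocycle_El (vert_span_triv v). Qed.

Lemma cocycle_triv_r v a : f a (e v) = 0.
Proof. exact: cocycle_Er (vert_span_triv v). Qed.

Lemma ext_mulE (x y : ext f) :
  x * y = (x.1 * y.1, x.1 * y.2 + x.2 * y.1 + f x.1 y.1).
Proof. by []. Qed.

Lemma ext_mulr_linear (x : ext f) : linear (fun y : ext f => x * y).
Proof.
move=> c u v; rewrite !ext_mulE; congr (_, _).
  by rewrite /= mulrDr quot_scaleAr.
rewrite /= cocycle_linear_r !mulrDr -!quot_scaleAr !scalerDr.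
by rewrite (addrACA (c *: _)) [LHS]addrACA.
Qed.

Lemma ext_mull_linear (y : ext f) : linear (fun x : ext f => x * y).
Proof.
move=> c u v; rewrite !ext_mulE; congr (_, _).
  by rewrite /= mulrDl quot_scaleAl.
rewrite /= cocycle_linear_l !mulrDl -!quot_scaleAl !scalerDr.
by rewrite (addrACA (c *: _)) [LHS]addrACA.
Qed.

Definition ext_vert (v : vert Q) : ext f := (e v, 0).

Definition ext_arrow (b : arr Qf) : ext f :=
  match b with
  | inl a => (pcls I (parrow a), 0)
  | inr u => (0, e (val u))
  end.

Lemma pclsM p q :
  pcls I p * pcls I q = if ptgt p == psrc q then pcls I (pcat p q) else 0.
Proof.
rewrite /pcls -rmorphM /= pvecM /pmul; case: eqP => // _; exact: raddf0.
Qed.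

Lemma triv_pclsM p : e (psrc p) * pcls I p = pcls I p.
Proof. by rewrite pclsM eqxx pcat1p. Qed.

Lemma pcls_trivM p : pcls I p * e (ptgt p) = pcls I p.
Proof. by rewrite pclsM eqxx pcatp1. Qed.

Lemma ext_vert_orth u v :
  ext_vert u * ext_vert v = if u == v then ext_vert u else 0.
Proof.
rewrite ext_mulE /= cocycle_triv_l mulr0 mul0r !addr0 -rmorphM triv_orth.
by case: eqP => // _; rewrite raddf0.
Qed.

Lemma ext_vert_src (b : arr Qf) :
  ext_vert (src b : vert Qf) * ext_arrow b = ext_arrow b.
Proof.
rewrite ext_mulE; case: b => [a|u] /=.
  by rewrite cocycle_triv_l mulr0 mul0r !addr0 (triv_pclsM (parrow a)).
by rewrite mulr0 cocycle_triv_l mul0r !addr0 (triv_pclsM (ptriv _)).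
Qed.

Lemma ext_vert_tgt (b : arr Qf) :
  ext_arrow b * ext_vert (tgt b : vert Qf) = ext_arrow b.
Proof.
rewrite ext_mulE; case: b => [a|u] /=.
  by rewrite cocycle_triv_r mulr0 mul0r !addr0 (pcls_trivM (parrow a)).
rewrite mulr0 cocycle_triv_r mul0r add0r addr0.
by rewrite (pcls_trivM (ptriv (val u))).
Qed.

Definition ext_eval (x : pathalg k Qf) : ext f :=
  lext (@peval (ext f) Qf ext_vert ext_arrow) x.

Lemma ext_eval_linear : linear ext_eval.
Proof. exact: lext_is_linear. Qed.

HB.instance Definition _ := GRing.isLinear.Build k (pathalg k Qf) (ext f) *:%R
  ext_eval ext_eval_linear.

Lemma ext_eval_pvec p : ext_eval (pvec k p) = @peval _ Qf ext_vert ext_arrow p.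
Proof. exact: lext_pvec. Qed.

Lemma ext_evalM : {morph ext_eval : x y / x * y}.
Proof.
apply: (lext_mul ext_mulr_linear ext_mull_linear) => p q.
rewrite (@peval_mul _ Qf _ _ ext_vert_orth ext_vert_src ext_vert_tgt) /pmul.
by case: eqP => _; rewrite ?lext_pvec // linear0.
Qed.

Lemma ext_eval_triv v : ext_eval (pvec k (ptriv v)) = ext_vert v.
Proof. by rewrite ext_eval_pvec /peval big_nil mulr1. Qed.

Lemma ext_eval_arrow b : ext_eval (pvec k (parrow b)) = ext_arrow b.
Proof. by rewrite ext_eval_pvec /peval big_seq1 ext_vert_src. Qed.

Lemma ext_eval1 : ext_eval 1 = 1.
Proof.
rewrite pathalg1 raddf_sum /=; under eq_bigr do rewrite ext_eval_triv.
transitivity (\sum_v e v, 0 : quot I); last first.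
  by congr (_, _); rewrite -(rmorph1 (cls I)) pathalg1 raddf_sum.
apply: (big_ind2 (fun (x : ext f) y => x = (y, 0))) => //.
by move=> _ x _ y -> ->; congr (_, _); rewrite addr0.
Qed.

HB.instance Definition _ := GRing.isMonoidMorphism.Build (pathalg k Qf) (ext f)
  ext_eval (ext_eval1, ext_evalM).

(** * The map [fhat] as second component of the evaluation *)

Lemma fhat_linear : linear (fhat f).
Proof. exact: lext_is_linear. Qed.

HB.instance Definition _ := GRing.isLinear.Build k (pathalg k Q) (quot I) *:%R
  (fhat f) fhat_linear.

Lemma fhat_pvec p : fhat f (pvec k p) = fhat_path f p.
Proof. exact: lext_pvec. Qed.

Lemma pcls_prod p : pcls I p =
  e (psrc p) * \prod_(b <- [seq pcls I (parrow a) | a <- parr p]) b.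
Proof.
rewrite {1}/pcls pvec_prod /peval rmorphM rmorph_prod /= big_map.
by [].
Qed.

(* The factor [e v] is absorbed by the first arrow; for [s] a single arrow it
   gives the term [f (e v) _], which vanishes. *)
Lemma ext_prod_hat (v : vert Q) (s : seq (arr Q)) :
    (if s is a :: _ then src a == v else true) ->
  let bs := [seq pcls I (parrow a) | a <- s] in
  ext_vert v * \prod_(a <- s) ext_arrow (inl a) =
    (e v * \prod_(b <- bs) b,
     \sum_(1 <= i < size bs)
       f (\prod_(b <- take i bs) b) bs`_i * \prod_(b <- drop i.+1 bs) b).
Proof.
elim/last_ind: s => [|s a IHs] sv bs.
  by rewrite /bs !big_nil !mulr1.
rewrite {}/bs map_rcons; move: IHs; set bs := map _ s => IHs.
rewrite !prod_rcons !mulrA IHs; last by case: s sv {IHs bs}.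
rewrite ext_mulE /= mulr0 add0r; congr (_, _).
rewrite size_rcons; case: (posnP (size bs)) => [bs0|bs_gt0].
  rewrite (size0nil bs0) /= big_nil !big_geq // mulr1 mul0r add0r.
  exact: cocycle_triv_l.
(* Multiplying by the last arrow extends every earlier term on the right and adds, through the
   cocycle, the term of index [size bs]. *)
rewrite big_nat_recr //= nth_rcons ltnn eqxx drop_oversize ?size_rcons //.
rewrite big_nil mulr1; congr (_ + _).
  rewrite mulr_suml; apply: eq_big_nat => i /andP[_ ilt].
  rewrite nth_rcons ilt drop_rcons // prod_rcons mulrA.
  by rewrite -cats1 takel_cat // ltnW.
rewrite -cats1 take_size_cat //; congr (f _ _).
move: bs_gt0; rewrite {IHs}/bs; case: s sv => //= a' s /eqP <- _.
by rewrite big_cons mulrA (triv_pclsM (parrow a')).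
Qed.

(** [fhat] is what the cocycle accumulates in the second component when the pairs of the arrows are
    multiplied; both sides are linear, so paths suffice. *)
Lemma ext_eval_hat x : ext_eval (hat f x) = (cls I x, fhat f x).
Proof.
apply: (@pathalg_ext k Q (ext f) (fun x => ext_eval (hat f x))
  (fun x => (cls I x, fhat f x))) => [c u v|c u v|p].
- by rewrite !linearP.
- by congr (_, _); rewrite linearP.
rewrite hat_pvec ext_eval_pvec fhat_pvec -/(pcls I p) pcls_prod.
rewrite /peval -[parr (hat_path f p)]/(map (hat_arrow f) (parr p)).
rewrite [in LHS]big_map.
apply: ext_prod_hat.
by case: p => [[v [|a s]] ws] //; case/andP: (ws).
Qed.

(** Comparing second components in the multiplicativity of [ext_eval] after [hat] avoids splitting
    the sum that defines [fhat]. *)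
Lemma fhatM x y : fhat f (x * y) =
  cls I x * fhat f y + fhat f x * cls I y + f (cls I x) (cls I y).
Proof.
have E : ext_eval (hat f (x * y)) = ext_eval (hat f x) * ext_eval (hat f y).
  by rewrite hatM ext_evalM.
by have := etrans (esym (ext_eval_hat _))
  (etrans E (congr2 *%R (ext_eval_hat x) (ext_eval_hat y))) => -[].
Qed.

End ExtensionEvaluation.

(** * A square-zero element commuting with the image of the path algebra *)

Section SquareZeroCentral.
Variables (k : comNzRingType) (Q : quiver) (I : ideal (pathalg k Q)).
Hypothesis I_adm : admissible I.
Variables (P : {fset qpath Q}) (Gamma : {fset pathalg k Q}).
Hypothesis P_basis : path_basis I P.
Hypothesis Gamma_rel : forall rho, rho \in Gamma -> relation rho.
Hypothesis Gamma_gen : ideal_set I = ideal_set (ideal_gen [set` Gamma]).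
Variables (f : cocycle I) (w : pathalg k Q -> pathalg k Q).
Hypothesis w_supp : forall rho, rho \in Gamma -> {subset msupp (w rho) <= P}.
Hypothesis w_cls : forall rho, rho \in Gamma -> cls I (w rho) = fhat f rho.
Variable mu : vert Q -> pathalg k Q -> k.
Local Notation triv v := (pvec k (ptriv v)).
Local Notation mu_rel i := (\sum_(rho <- Gamma) mu i rho *: rho).

Lemma sum_mul_triv i b :
  mu_rel i * triv b =
  \sum_(rho <- Gamma | `[< has_target rho b >]) mu i rho *: rho.
Proof.
rewrite mulr_suml [RHS]big_mkcond; apply: eq_big_seq => rho rhoG.
have [rho0 _] := Gamma_rel rhoG.
have [j rhoj] := relation_target (Gamma_rel rhoG).
rewrite -pathalg_scaleAl (mul_triv_target _ rhoj).
case: eqP => [<-|jb]; first by rewrite asboolT.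
by rewrite scaler0 asboolF // => /(has_target_inj rho0 rhoj).
Qed.

(** Both sides lie in the span of [P], which contains the trivial paths, so they may be compared in
    [A]. There [fhatM] gives the product of the idempotents at [i] and [b]. *)
Lemma sum_w_target i b : pcls I (ptriv i) = fhat f (mu_rel i) ->
  \sum_(rho <- Gamma | `[< has_target rho b >]) mu i rho *: w rho =
  if i == b then triv i else 0.
Proof.
move=> im; apply: (basis_inj P_basis).
- move=> p; apply: contraTT => pP; rewrite -mcoeff_eq0 raddf_sum /=.
  rewrite big_seq_cond big1 // => rho /andP[rhoG _].
  rewrite mcoeffZ [(w rho)@_p]mcoeff_outdom ?mulr0 //.
  by apply: contra pP; apply: w_supp.
- case: eqP => _ p; last by rewrite msupp0.
  by rewrite pvecE msuppU oner_eq0 inE => /eqP ->; apply: triv_in_basis P_basis.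
transitivity (fhat f (mu_rel i * triv b)).
  rewrite sum_mul_triv !raddf_sum /= big_seq_cond [RHS]big_seq_cond.
  apply: eq_bigr => rho /andP[rhoG _].
  by rewrite [LHS]linearZ [RHS]linearZ /= w_cls.
rewrite fhatM -im -/(pcls I (ptriv b)) cocycle_triv_r fhat_pvec /fhat_path /=.
rewrite big_geq // mulr0 add0r addr0 -rmorphM triv_orth.
by case: eqP.
Qed.

(** * A ring with elements [ep i] subject to the relations of [ideal_f] *)

Variables (B : pzRingType) (h : {rmorphism pathalg k Q -> B}).
Variable ep : vert Q -> B.
(** [B] is only a ring, so centrality of the images of scalars stands in for linearity of [h]. *)
Hypothesis h_scalar : forall c u,
  h (c *: (1 : pathalg k Q)) * u = u * h (c *: (1 : pathalg k Q)).
Hypothesis ep_sqr : forall i, ep i * ep i = 0.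
Hypothesis ep_arrow : forall a : arr Q,
  ep (src a) * h (pvec k (parrow a)) = h (pvec k (parrow a)) * ep (tgt a).
Hypothesis h_Gamma : forall rho j, rho \in Gamma -> has_target rho j ->
  h rho = h (w rho) * ep j.
(** The alternatives reflect the two forms of [eps i]: a loop at [i], or a combination of
    relations. *)
Hypothesis ep_cases : forall i,
  (h (triv i) * ep i = ep i /\ ep i * h (triv i) = ep i) \/
  (pcls I (ptriv i) = fhat f (mu_rel i) /\ ep i = h (mu_rel i)).

Lemma sum_h_triv : \sum_b h (triv b) = 1.
Proof. by rewrite -(rmorph1 h) pathalg1 raddf_sum. Qed.

Lemma h_triv_orth i b :
  h (triv i) * h (triv b) = if i == b then h (triv i) else 0.
Proof. by rewrite -rmorphM triv_orth; case: eqP => // _; apply: rmorph0. Qed.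

(** The factor [h (triv i)] stays because the second alternative of [ep_cases] does not yet show
    that it fixes [ep i]; summing over [b] gives this in [triv_ep]. *)
Lemma ep_triv_aux i b :
  ep i * h (triv b) = if i == b then h (triv i) * ep i else 0.
Proof.
case: (ep_cases i) => [[ei ie]|[im epE]].
  rewrite -ie -mulrA h_triv_orth; case: eqP => [_|]; last by rewrite mulr0.
  by rewrite ie ei.
rewrite [in LHS]epE -rmorphM sum_mul_triv.
(* [h_Gamma] turns each relation ending at [b] into [h (w rho) * ep b], and [sum_w_target] evaluates
   the combination of the [w rho]. *)
transitivity (h (if i == b then triv i else 0) * ep b).
  rewrite -(sum_w_target _ im) [in LHS](raddf_sum h) [in RHS](raddf_sum h).
  rewrite mulr_suml big_seq_cond.
  rewrite [RHS]big_seq_cond; apply: eq_bigr => rho /andP[rhoG /asboolP rhob].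
  rewrite pathalg_scaleE [in RHS]pathalg_scaleE /= !rmorphM -mulrA.
  by rewrite (h_Gamma rhoG rhob).
by case: eqP => [->//|_]; rewrite rmorph0 mul0r.
Qed.

(* When [ep i] is the image of a combination of relations, some of these need
   not be loops at [i]; the identity then relies on [h_Gamma]. *)
Lemma triv_ep i : h (triv i) * ep i = ep i.
Proof.
rewrite -[RHS]mulr1 -sum_h_triv mulr_sumr (bigD1 i) //= ep_triv_aux eqxx.
rewrite big1 ?addr0 // => b bi.
by rewrite ep_triv_aux eq_sym (negPf bi).
Qed.

Lemma ep_triv i b : ep i * h (triv b) = if i == b then ep i else 0.
Proof. by rewrite ep_triv_aux triv_ep. Qed.

Lemma triv_ep_if b i : h (triv b) * ep i = if b == i then ep i else 0.
Proof.
rewrite -[in LHS]triv_ep mulrA h_triv_orth; case: eqP => [->|_].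
  exact: triv_ep.
exact: mul0r.
Qed.

Definition sum_ep : B := \sum_i ep i.

Lemma sum_ep_triv b : sum_ep * h (triv b) = ep b.
Proof.
rewrite mulr_suml (bigD1 b) //= ep_triv eqxx big1 ?addr0 // => i ib.
by rewrite ep_triv (negPf ib).
Qed.

Lemma triv_sum_ep b : h (triv b) * sum_ep = ep b.
Proof.
rewrite mulr_sumr (bigD1 b) //= triv_ep big1 ?addr0 // => i ib.
by rewrite triv_ep_if eq_sym (negPf ib).
Qed.

Lemma ep_sum_ep i : ep i * sum_ep = 0.
Proof.
rewrite mulr_sumr big1 // => j _; rewrite -(triv_ep j) mulrA ep_triv.
by case: eqP => [->|_]; rewrite ?ep_sqr ?mul0r.
Qed.

Lemma sum_ep_sqr : sum_ep * sum_ep = 0.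
Proof. by rewrite {1}/sum_ep mulr_suml big1 // => i _; apply: ep_sum_ep. Qed.

(** It commutes with scalars and trivial paths, and moves past a path one arrow at a time. *)
Lemma sum_ep_comm x : sum_ep * h x = h x * sum_ep.
Proof.
have comm_triv v : sum_ep * h (triv v) = h (triv v) * sum_ep.
  by rewrite sum_ep_triv triv_sum_ep.
rewrite (pathalg_expand x) (raddf_sum h) [LHS]mulr_sumr [RHS]mulr_suml /=.
apply: eq_bigr => p _; rewrite pathalg_scaleE rmorphM mulrA -h_scalar -!mulrA.
congr (_ * _); rewrite pvec_prod /peval rmorphM mulrA comm_triv -!mulrA.
congr (_ * _); elim: (parr p) => [|a s IHs].
  by rewrite big_nil rmorph1 mulr1 mul1r.
rewrite big_cons rmorphM -[RHS]mulrA -IHs !mulrA; congr (_ * _).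
(* The trivial paths at the two ends of the arrow cut [sum_ep] down to [ep (src a)] and
   [ep (tgt a)], where [ep_arrow] applies. *)
rewrite -{1}(triv_arrow k a) -{2}(arrow_triv k a) !rmorphM mulrA sum_ep_triv.
by rewrite ep_arrow -mulrA triv_sum_ep.
Qed.

(** The elements with this property form a two-sided ideal, as [sum_ep] commutes with the image of
    [h], and this ideal contains the relations. *)
Lemma h_ideal x : ideal_set I x -> exists y, h x = h y * sum_ep.
Proof.
rewrite Gamma_gen.
apply: (@ideal_gen_sub _ _ [set x | exists y, h x = h y * sum_ep]) => [|rho].
  split=> [|y z [y' yE] [z' zE]|a y [y' yE]|a y [y' yE]].
  - by exists 0; rewrite !rmorph0 mul0r.
  - by exists (y' + z'); rewrite !rmorphD mulrDl yE zE.
  - by exists (a * y'); rewrite !rmorphM yE mulrA.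
  - by exists (y' * a); rewrite !rmorphM yE -!mulrA sum_ep_comm.
move=> rhoG; have [j rhoj] := relation_target (Gamma_rel rhoG).
(* The factor [triv j] cuts [sum_ep] down to the [ep j] of [h_Gamma]. *)
exists (w rho * triv j).
by rewrite (h_Gamma rhoG rhoj) rmorphM -mulrA triv_sum_ep.
Qed.

(** Consequently [h v * sum_ep] depends only on the class of [v] in [A]. *)
Lemma h_ideal_sum_ep x : ideal_set I x -> h x * sum_ep = 0.
Proof. by case/h_ideal => y ->; rewrite -mulrA sum_ep_sqr mulr0. Qed.

Definition hat_span : set B := [set r | exists u v, r = h u + h v * sum_ep].

Lemma hat_span_hat x : hat_span (h x).
Proof. by exists x, 0; rewrite rmorph0 mul0r addr0. Qed.

Lemma hat_span_ep i : hat_span (ep i).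
Proof. by exists 0, (triv i); rewrite rmorph0 add0r triv_sum_ep. Qed.

Lemma hat_spanD r s : hat_span r -> hat_span s -> hat_span (r + s).
Proof.
move=> [u [v ->]] [u' [v' ->]]; exists (u + u'), (v + v').
by rewrite !rmorphD mulrDl addrACA.
Qed.

(** The product is that of dual numbers: [sum_ep] moves to the right, and its square vanishes. *)
Lemma hat_spanM r s : hat_span r -> hat_span s -> hat_span (r * s).
Proof.
move=> [u [v ->]] [u' [v' ->]]; exists (u * u'), (u * v' + v * u').
have E0 : (h v * sum_ep) * (h v' * sum_ep) = 0.
  by rewrite -mulrA (mulrA sum_ep) sum_ep_comm -mulrA sum_ep_sqr !mulr0.
rewrite rmorphD !rmorphM mulrDr !mulrDl E0 addr0 -addrA; congr (_ + _).
by rewrite addrC -(mulrA (h v)) sum_ep_comm !mulrA.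
Qed.

End SquareZeroCentral.

(** * Image and kernel of the evaluation morphism *)

Section Presentation.
Variables (k : comNzRingType) (Q : quiver) (I : ideal (pathalg k Q)).
Hypothesis I_adm : admissible I.
Variables (P : {fset qpath Q}) (Gamma : {fset pathalg k Q}).
Hypothesis P_basis : path_basis I P.
Hypothesis Gamma_rel : forall rho, rho \in Gamma -> relation rho.
Hypothesis Gamma_gen : ideal_set I = ideal_set (ideal_gen [set` Gamma]).
Variables (f : cocycle I) (w : pathalg k Q -> pathalg k Q).
Hypothesis w_supp : forall rho, rho \in Gamma -> {subset msupp (w rho) <= P}.
Hypothesis w_cls : forall rho, rho \in Gamma -> cls I (w rho) = fhat f rho.
Variable mu : vert Q -> pathalg k Q -> k.
Hypothesis mu_fhat : forall i, cocycle_im f (pcls I (ptriv i)) ->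
  pcls I (ptriv i) = fhat f (\sum_(rho <- Gamma) mu i rho *: rho).

Local Notation Qf := (quiver_f f).
Local Notation e v := (pcls I (ptriv v)).
Local Notation eps := (eps f Gamma mu).
Local Notation J := (ideal_f f Gamma w mu).
Local Notation c := (cls J).
Local Notation triv v := (pvec k (ptriv v)).

Lemma epsE i :
  (exists2 u : loop_index f,
     i = val u & eps i = pvec k (parrow (loop_arrow u))) \/
  (cocycle_im f (e i) /\ eps i = \sum_(rho <- Gamma) mu i rho *: hat f rho).
Proof.
rewrite /Defs.eps; case: insubP => [u _ ui|]; first by left; exists u.
by move=> /asboolPn/contrapT; right.
Qed.

Lemma cls_Gamma rho : rho \in Gamma -> cls I rho = 0.
Proof.
by move=> rhoG; apply/cls_eq0; rewrite Gamma_gen; apply: sub_ideal_gen.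
Qed.

(** When [eps i] is a combination of relations, these vanish in [A], and [mu_fhat] gives the second
    component. *)
Lemma ext_eval_eps i : ext_eval (eps i) = (0, e i).
Proof.
case: (epsE i) => [[u -> ->]|[im ->]]; first exact: ext_eval_arrow.
under eq_bigr do rewrite -linearZ /=.
rewrite -(raddf_sum (hat f)) /= ext_eval_hat -mu_fhat //; congr (_, _).
rewrite raddf_sum /= big_seq big1 // => rho /cls_Gamma rho0.
by rewrite linearZ /= rho0 scaler0.
Qed.

Lemma ext_eval_eps_hat i x : ext_eval (eps i * hat f x) = (0, e i * cls I x).
Proof.
rewrite ext_evalM ext_eval_eps ext_eval_hat ext_mulE /=.
by rewrite cocycle0l !mul0r add0r addr0.
Qed.

Lemma ext_eval_hat_eps i x : ext_eval (hat f x * eps i) = (0, cls I x * e i).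
Proof.
rewrite ext_evalM ext_eval_eps ext_eval_hat ext_mulE /=.
by rewrite cocycle0r !mulr0 !addr0.
Qed.

Lemma ext_eval_gen_f : gen_f f Gamma w mu `<=` [set x | ext_eval x = 0].
Proof.
move=> x [[i ->]|[a ->]|[rho [j [rhoG rhoj ->]]]] /=.
- rewrite expr2 ext_evalM ext_eval_eps ext_mulE /=.
  by rewrite !mul0r mulr0 cocycle0l !addr0.
- apply/eqP; rewrite raddfB subr_eq0; apply/eqP.
  rewrite [LHS]ext_eval_eps_hat [RHS]ext_eval_hat_eps.
  by rewrite (triv_pclsM I (parrow a)) (pcls_trivM I (parrow a)).
apply/eqP; rewrite raddfB subr_eq0; apply/eqP.
rewrite [LHS]ext_eval_hat [RHS]ext_eval_hat_eps.
rewrite (cls_Gamma rhoG) (w_cls rhoG); congr (_, _).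
(* Inserting the trivial path at the target shows that [fhat f rho] is fixed by right multiplication
   by [e j]. *)
rewrite -[in LHS](mul_triv_target_id rhoj) fhatM.
rewrite fhat_pvec /fhat_path /= big_geq // mulr0 add0r.
by rewrite -/(e j) cocycle_triv_r addr0.
Qed.

Lemma ext_eval_ideal_f x : ideal_set J x -> ext_eval x = 0.
Proof.
apply: (ideal_gen_sub _ ext_eval_gen_f).
split=> [|y z /= y0 z0|a y /= y0|a y /= y0] /=.
- exact: raddf0.
- by rewrite raddfD /= y0 z0 addr0.
- by rewrite ext_evalM y0 mulr0.
- by rewrite ext_evalM y0 mul0r.
Qed.

Definition eta : pathalg k Qf := \sum_i eps i.

Lemma ext_eval_eta : ext_eval eta = (0, 1).
Proof.
rewrite raddf_sum /=; under eq_bigr do rewrite ext_eval_eps.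
rewrite -(rmorph1 (cls I)) pathalg1 raddf_sum.
apply: (big_ind2 (fun (x : ext f) y => x = (0, y))) => //.
by move=> _ x _ y -> ->; congr (_, _); rewrite addr0.
Qed.

Lemma ext_eval_hat_mul_eta x : ext_eval (hat f x * eta) = (0, cls I x).
Proof.
rewrite ext_evalM ext_eval_eta ext_eval_hat ext_mulE /=.
by rewrite cocycle0r !mulr0 mulr1 !addr0.
Qed.

Lemma ext_eval_hat_eta x y :
  ext_eval (hat f x + hat f y * eta) = (cls I x, fhat f x + cls I y).
Proof.
rewrite raddfD [LHS](congr2 +%R (ext_eval_hat f x) (ext_eval_hat_mul_eta y)).
by congr (_, _); rewrite /= addr0.
Qed.

Lemma ext_eval_surj (r : ext f) : exists x, ext_eval x = r.
Proof.
case: r => [a b].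
(* The first summand evaluates to [(a, fhat f (repr a))]; the multiple of [eta] corrects the second
   component. *)
exists (hat f (repr a) + hat f (repr (b - fhat f (repr a))) * eta).
by rewrite ext_eval_hat_eta !cls_repr addrC subrK.
Qed.

(** * Relations and normal forms in the quotient by [ideal_f] *)

Lemma cls_gen_f x : gen_f f Gamma w mu x -> c x = 0.
Proof. by move=> Jx; apply/cls_eq0; apply: sub_ideal_gen. Qed.

Definition quot_hat : {rmorphism pathalg k Q -> quot J} := c \o hat f.

Definition quot_eps i : quot J := c (eps i).

Lemma quot_eps_sqr i : quot_eps i * quot_eps i = 0.
Proof. by rewrite -rmorphM -expr2; apply: cls_gen_f; constructor; exists i. Qed.

Lemma quot_eps_arrow (a : arr Q) :
  quot_eps (src a) * quot_hat (pvec k (parrow a)) =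
  quot_hat (pvec k (parrow a)) * quot_eps (tgt a).
Proof.
rewrite /quot_hat /quot_eps /=.
apply/eqP; rewrite -subr_eq0 -!rmorphM -rmorphB; apply/eqP/cls_gen_f.
by constructor 2; exists a.
Qed.

Lemma quot_hat_Gamma rho j : rho \in Gamma -> has_target rho j ->
  quot_hat rho = quot_hat (w rho) * quot_eps j.
Proof.
move=> rhoG rhoj; rewrite /quot_hat /quot_eps /=.
apply/eqP; rewrite -subr_eq0 -rmorphM -rmorphB.
by apply/eqP/cls_gen_f; constructor 3; exists rho, j.
Qed.

Lemma quot_hat_scalar (d : k) (u : quot J) :
  quot_hat (d *: (1 : pathalg k Q)) * u = u * quot_hat (d *: (1 : pathalg k Q)).
Proof.
have -> : quot_hat (d *: (1 : pathalg k Q)) = d *: (1 : quot J).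
  by rewrite /quot_hat /= linearZ /= hat1 linearZ /= rmorph1.
by rewrite -quot_scaleAl -quot_scaleAr mul1r mulr1.
Qed.

Lemma hat_triv v : hat f (triv v) = pvec k (@ptriv Qf v).
Proof. by rewrite hat_pvec; congr (pvec k _); apply: val_inj. Qed.

Lemma quot_eps_cases i :
  (quot_hat (triv i) * quot_eps i = quot_eps i /\
   quot_eps i * quot_hat (triv i) = quot_eps i) \/
  (e i = fhat f (\sum_(rho <- Gamma) mu i rho *: rho) /\
   quot_eps i = quot_hat (\sum_(rho <- Gamma) mu i rho *: rho)).
Proof.
rewrite /quot_eps; case: (epsE i) => [[u -> ->]|[im ->]]; [left | right].
  rewrite /quot_hat /= hat_triv -!rmorphM /=.
  by rewrite (triv_arrow k (loop_arrow u)) (arrow_triv k (loop_arrow u)).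
split; first exact: mu_fhat.
rewrite /quot_hat /= (raddf_sum (hat f)); congr c.
by apply: eq_bigr => rho _; rewrite [RHS]linearZ.
Qed.

Local Notation E := (sum_ep quot_eps).

Lemma cls_eta : c eta = E.
Proof. exact: raddf_sum. Qed.

Lemma quot_hat_ideal x : ideal_set I x -> exists y, quot_hat x = quot_hat y * E.
Proof.
exact: (h_ideal I_adm P_basis Gamma_rel Gamma_gen w_supp w_cls quot_hat_scalar
  quot_eps_arrow quot_hat_Gamma quot_eps_cases).
Qed.

Lemma quot_hat_ideal_sum x : ideal_set I x -> quot_hat x * E = 0.
Proof.
exact: (h_ideal_sum_ep I_adm P_basis Gamma_rel Gamma_gen w_supp w_cls
  quot_hat_scalar quot_eps_sqr quot_eps_arrow quot_hat_Gamma quot_eps_cases).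
Qed.

Local Notation hat_span := (hat_span quot_hat quot_eps).

Lemma quot_hat_spanM r s : hat_span r -> hat_span s -> hat_span (r * s).
Proof.
exact: (hat_spanM I_adm P_basis Gamma_rel w_supp w_cls quot_hat_scalar
  quot_eps_sqr quot_eps_arrow quot_hat_Gamma quot_eps_cases).
Qed.

Lemma hat_span_arrow (b : arr Qf) : hat_span (c (pvec k (parrow b))).
Proof.
case: b => [a|u].
  have <- : quot_hat (pvec k (parrow a)) = c (pvec k (@parrow Qf (inl a))).
    by rewrite /quot_hat /= hat_pvec; congr (c (pvec k _)); apply: val_inj.
  exact: hat_span_hat.
case: (epsE (val u)) => [[u' /val_inj <- <-]|[im _]].
  exact: (hat_span_ep I_adm P_basis Gamma_rel w_supp w_cls quot_hat_Gamma
    quot_eps_cases).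
(* By definition, [u] indexes a vertex whose idempotent is outside the image of the cocycle. *)
by case/asboolP: (valP u).
Qed.

Lemma hat_span_scalar d : hat_span (c (d *: (1 : pathalg k Qf))).
Proof.
have <- : quot_hat (d *: (1 : pathalg k Q)) = c (d *: (1 : pathalg k Qf)).
  by rewrite /quot_hat /= linearZ /= hat1.
exact: hat_span_hat.
Qed.

(** Scalars, trivial paths and arrows generate the path algebra, and [hat_span] contains their
    classes and is closed under sums and products. *)
Lemma hat_span_cls x : hat_span (c x).
Proof.
rewrite (pathalg_expand x) (raddf_sum c).
apply: (big_ind hat_span) => [|r s|p _].
- by rewrite -(rmorph0 quot_hat); apply: hat_span_hat.
- exact: hat_spanD.
rewrite /= pathalg_scaleE (rmorphM c) pvec_prod /peval (rmorphM c).
apply: quot_hat_spanM; last apply: quot_hat_spanM.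
- exact: hat_span_scalar.
- by rewrite -hat_triv; apply: hat_span_hat.
rewrite (rmorph_prod c); apply: (big_ind hat_span) => [|r s|b _].
- by rewrite -(rmorph1 quot_hat); apply: hat_span_hat.
- exact: quot_hat_spanM.
exact: hat_span_arrow.
Qed.

Lemma ext_eval_cls x y : c x = c y -> ext_eval x = ext_eval y.
Proof.
move=> /clsP/ext_eval_ideal_f/eqP.
by rewrite raddfB subr_eq0 => /eqP.
Qed.

Lemma ext_eval_ker x : ext_eval x = 0 <-> ideal_set J x.
Proof.
split=> [x0|]; last exact: ext_eval_ideal_f.
have [u [v xuv]] := hat_span_cls x.
have xE : c x = c (hat f u + hat f v * eta).
  by rewrite xuv -cls_eta (rmorphD c) (rmorphM c).
have [/cls_eq0 Iu _] : (cls I u, fhat f u + cls I v) = 0 :> ext f.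
  by rewrite -ext_eval_hat_eta -(ext_eval_cls xE).
have [y uy] := quot_hat_ideal Iu.
have xyv : c x = quot_hat (y + v) * E.
  by rewrite xuv uy (rmorphD quot_hat) mulrDl.
(* With both parts merged into one multiple of [E], a second evaluation puts [y + v] in [I]. *)
have [/cls_eq0 Iyv] : (0, cls I (y + v)) = 0 :> ext f.
  rewrite -ext_eval_hat_mul_eta -x0; apply: ext_eval_cls.
  by rewrite xyv -cls_eta (rmorphM c).
by apply/cls_eq0; rewrite xyv quot_hat_ideal_sum.
Qed.

End Presentation.

Theorem theorem5p5 (k : closedFieldType) (Q : quiver)
    (I : ideal (pathalg k Q)) (I_adm : admissible I)
    (P : {fset qpath Q}) (P_basis : path_basis I P)
    (Gamma : {fset pathalg k Q})
    (Gamma_rel : forall rho, rho \in Gamma -> relation rho)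
    (Gamma_gen : ideal_set I = ideal_set (ideal_gen [set` Gamma]))
    (f : cocycle I)
    (Im_f : cocycle_im f `<=` fhat f @` ideal_set I)
    (w : pathalg k Q -> pathalg k Q)
    (w_supp : forall rho, rho \in Gamma -> {subset msupp (w rho) <= P})
    (w_cls : forall rho, rho \in Gamma -> cls I (w rho) = fhat f rho)
    (mu : vert Q -> pathalg k Q -> k)
    (mu_fhat : forall i, cocycle_im f (pcls I (ptriv i)) ->
       pcls I (ptriv i) = fhat f (\sum_(rho <- Gamma) mu i rho *: rho)) :
  exists phi : {rmorphism ext f -> quot (ideal_f f Gamma w mu)},
    scalable phi /\ bijective phi.
Proof.
have surj := ext_eval_surj Gamma_gen mu_fhat.
have ker := ext_eval_ker I_adm P_basis Gamma_rel Gamma_gen w_supp w_cls mu_fhat.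
have [phi phiE phi_bij] := first_isomorphism surj ker.
(* [phi] comes only as a ring morphism; its compatibility with scalars is read off on a preimage,
   where [ext_eval] and the class map are linear. *)
exists phi; split=> // d r; have [x <-] := surj r.
by rewrite -linearZ /= !phiE linearZ.
Qed.
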